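(* A Cayley permutation $\pi=\pi_1\cdots\pi_n$ is not $21$-sortable if and only if either $\pi$ contains the pattern $2341$, or $\pi$ contains an occurrence $\pi_{i_1}\pi_{i_2}\pi_{i_3}\pi_{i_4}$ ($i_1<i_2<i_3<i_4$) of the pattern $3241$ such that every entry $\pi_x$ with $i_1<x<i_2$ satisfies $\pi_x<\pi_{i_3}$. In particular, $\mathrm{Sort}(21)$ is not a class; for example, the $21$-sortable Cayley permutation $34241$ contains the non-$21$-sortable pattern $3241$.
   Context: A Cayley permutation is a finite word $\pi=\pi_1\cdots\pi_n$ over the positive integers such that every integer from $1$ to $\max(\pi)$ occurs at least once; $\mathcal{C}$ is the set of all Cayley permutations. A word $x=x_1\cdots x_n$ contains a pattern $p=p_1\cdots p_k$ if there are indices $i_1<\cdots<i_k$ such that for all $u,v$: $x_{i_u}<x_{i_v}$ iff $p_u<p_v$, and $x_{i_u}=x_{i_v}$ iff $p_u=p_v$ (such a subsequence is an occurrence of $p$); otherwise $x$ avoids $p$. A class is a subset of $\mathcal{C}$ closed downwards under pattern containment. A $21$-stack processes an input word from left to right with the following right-greedy algorithm: while the input is nonempty, if pushing the next input element onto the stack yields stack contents which, read from top to bottom, avoid the pattern $21$ (i.e. are weakly increasing from top to bottom), the element is pushed; otherwise the top element is popped and appended to the output. When the input is exhausted, the remaining elements are popped one by one. The $21$-machine consists of two $21$-stacks in series: the output of the first $21$-stack on input $\pi$ is fed as input to a second $21$-stack. $\pi$ is $21$-sortable if the final output is weakly increasing; $\mathrm{Sort}(21)$ is the set of $21$-sortable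 Cayley permutations. *)

(* Defs.v *)
(* Words are [seq nat]; positions in a word are 0-based. *)
From mathcomp Require Import all_boot.
Set Implicit Arguments.
Unset Strict Implicit.
Unset Printing Implicit Defensive.

(* The empty word counts as a Cayley permutation (its maximum is 0). *)
Definition cayley (w : seq nat) : bool :=
  all (fun a => 0 < a) w
  && all (fun k => k \in w) (iota 1 (\max_(a <- w) a)).

(* [idx] lists the positions i_1 < ... < i_k in [x] of an occurrence of [p];
   the subsequence itself is [seq nth 0 x i | i <- idx]. *)
Definition occurrence (p x idx : seq nat) : bool :=
  [&& size idx == size p,
      sorted ltn idx,
      all (fun i => i < size x) idx &
      [forall u : 'I_(size p), forall v : 'I_(size p),
         let xu := nth 0 x (nth 0 idx u) in
         let xv := nth 0 x (nth 0 idx v) in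
         ((xu < xv) == (nth 0 p u < nth 0 p v))
         && ((xu == xv) == (nth 0 p u == nth 0 p v))]].

Definition contains (p x : seq nat) : bool :=
  [exists idx : (size p).-tuple 'I_(size x),
     occurrence p x [seq val i | i <- idx]].

Definition avoids (p x : seq nat) : bool := ~~ contains p x.

Definition is_class (A : seq nat -> Prop) : Prop :=
  (forall w, A w -> cayley w) /\
  (forall w s, A w -> cayley s -> contains s w -> A s).

(* Output still to be produced when [input] remains to be read and the stack
   holds [stack], listed from top to bottom.  The branch in which nothing can
   be popped is never reached, since a one-letter stack avoids 21. *)
Fixpoint stack21_from (input stack : seq nat) {struct input} : seq nat :=
  if input is a :: input' then
    (fix popping (s : seq nat) : seq nat :=
       if avoids [:: 2; 1] (a :: s) then stack21_from input' (a :: s)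
       else if s is top :: s' then top :: popping s'
       else [::]) stack
  else stack.

Definition stack21 (w : seq nat) : seq nat := stack21_from w [::].

Definition sortable21 (w : seq nat) : bool := sorted leq (stack21 (stack21 w)).

Definition Sort21 (w : seq nat) : Prop := cayley w /\ sortable21 w.

(* Main.v *)
(* Cut a word at its leftmost maximum, w = L m R.  Reading m empties the stack,
   after which m stays at the bottom until the end, so stack21 w is
   stack21 L ++ stack21 R ++ [m], as for West's stack sorting.  Induction along
   this recursion shows that b precedes a < b in stack21 w exactly when w
   contains b c a with c > b.  Applied to the second pass, w is unsortable iff
   b c a with a < b < c occurs in stack21 w.  The same induction pulls this
   occurrence back to w.  When b, c come from L and a from R, the maximum m
   separates them: b c m a is a 2341 if b precedes c in L; otherwise c b m a is
   a 3241 in which every entry between c and b is smaller than m. *)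
Require Import Defs.
From mathcomp Require Import all_boot.

(** * Pattern containment through subsequences *)

Definition order_iso (p s : seq nat) : bool :=
  (size s == size p) &&
  all (fun u => all (fun v =>
         ((nth 0 s u < nth 0 s v) == (nth 0 p u < nth 0 p v))
         && ((nth 0 s u == nth 0 s v) == (nth 0 p u == nth 0 p v)))
       (iota 0 (size p))) (iota 0 (size p)).

Lemma order_iso_ltn p s u v : order_iso p s -> u < size p -> v < size p ->
  (nth 0 s u < nth 0 s v) = (nth 0 p u < nth 0 p v).
Proof.
case/andP=> _ /allP iso lt_u lt_v.
have /allP/(_ v) := iso u ltac:(by rewrite mem_iota).
by rewrite mem_iota /= => /(_ lt_v) /andP [/eqP].
Qed.

Lemma occurrenceE p x idx : occurrence p x idx =
  [&& sorted ltn idx, all (fun i => i < size x) idx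
    & order_iso p [seq nth 0 x i | i <- idx]].
Proof.
rewrite /occurrence /order_iso size_map.
have [szE|] := eqVneq (size idx) (size p); last by rewrite !andbF.
rewrite !andTb; congr [&& _, _ & _].
apply/idP/idP => [/forallP iso | /allP iso]; [apply/allP => u | apply/forallP => u].
- rewrite mem_iota /= => lt_u; apply/allP => v; rewrite mem_iota /= => lt_v.
  have /forallP/(_ (Ordinal lt_v)) := iso (Ordinal lt_u).
  by rewrite /= !(nth_map 0) ?szE.
- apply/forallP => v; have /allP/(_ v) := iso u ltac:(by rewrite mem_iota /=).
  by rewrite mem_iota /= !(nth_map 0) ?szE ?ltn_ord // => /(_ isT).
Qed.

Lemma subseq_nth (x idx : seq nat) :
  sorted ltn idx -> all (fun i => i < size x) idx ->
  subseq [seq nth 0 x i | i <- idx] x.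
Proof.
move=> srt /allP ltx; rewrite -{2}(mkseq_nth 0 x); apply: map_subseq.
(* A strictly increasing list is determined by its members, so [idx] is a filtered [iota]. *)
have -> : idx = [seq i <- iota 0 (size x) | i \in idx].
  apply: (irr_sorted_eq ltn_trans ltnn) => //.
    exact: sorted_filter ltn_trans _ _ (iota_ltn_sorted _ _).
  move=> i; rewrite mem_filter mem_iota /=.
  by case: (boolP (i \in idx)) => // /ltx ->.
exact: filter_subseq.
Qed.

Lemma subseq_indices {s x : seq nat} : subseq s x ->
  exists idx, [/\ sorted ltn idx, all (fun i => i < size x) idx
                & s = [seq nth 0 x i | i <- idx]].
Proof.
case/subseqP=> m szm ->; exists (mask m (iota 0 (size x))); split.
- exact: subseq_sorted ltn_trans _ _ (mask_subseq _ _) (iota_ltn_sorted _ _).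
- by apply/allP => i /mem_mask; rewrite mem_iota.
- by rewrite map_mask -/(mkseq _ _) mkseq_nth.
Qed.

(** Subsequences replace index tuples from here on, because they can be split along a
    concatenation. *)
Lemma containsP p x :
  reflect (exists2 s, subseq s x & order_iso p s) (contains p x).
Proof.
apply: (iffP existsP) => [[t] | [s /subseq_indices [idx [srt ltx ->]] iso]].
  rewrite occurrenceE => /and3P [srt ltx iso].
  by exists [seq nth 0 x i | i <- map val t]; first exact: subseq_nth.
(* [pmap insub] loses no position, all of them being below [size x]. *)
have szE : size (pmap insub idx : seq 'I_(size x)) == size p.
  case/andP: iso; rewrite size_map => /eqP <- _.
  by rewrite size_pmap_sub -all_count.
have valE : map val (pmap insub idx : seq 'I_(size x)) = idx.
  rewrite (pmap_filter (insubK _)); apply/all_filterP.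
  by apply: sub_all ltx => i; rewrite isSome_insub.
by exists (Tuple szE); rewrite /= valE occurrenceE srt ltx.
Qed.

Lemma ltn_cmp {a b} : a < b ->
  ((a < b) = true) * ((b < a) = false) * ((a == b) = false) * ((b == a) = false).
Proof. by case: ltngtP. Qed.

Lemma order_iso21 b a : order_iso [:: 2; 1] [:: b; a] = (a < b).
Proof.
apply/idP/idP => [iso | ab]; first by have := order_iso_ltn _ _ 1 0 iso isT isT.
by rewrite /order_iso /= !ltnn !eqxx !(ltn_cmp ab).
Qed.

(** In both four-letter patterns the letters are named so that a < b < c < d; this chain settles all
    sixteen comparisons. *)
Lemma order_iso2341 b c d a :
  order_iso [:: 2; 3; 4; 1] [:: b; c; d; a] = [&& a < b, b < c & c < d].
Proof.
apply/idP/and3P => [iso | [ab bc cd]].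
  split; first exact: (order_iso_ltn _ _ 3 0 iso).
    exact: (order_iso_ltn _ _ 0 1 iso).
  exact: (order_iso_ltn _ _ 1 2 iso).
have [ac bd] := (ltn_trans ab bc, ltn_trans bc cd); have ad := ltn_trans ab bd.
by rewrite /order_iso /= !ltnn !eqxx !(ltn_cmp ab, ltn_cmp ac, ltn_cmp ad,
                                      ltn_cmp bc, ltn_cmp bd, ltn_cmp cd).
Qed.

Lemma order_iso3241 c b d a :
  order_iso [:: 3; 2; 4; 1] [:: c; b; d; a] = [&& a < b, b < c & c < d].
Proof.
apply/idP/and3P => [iso | [ab bc cd]].
  split; first exact: (order_iso_ltn _ _ 3 1 iso).
    exact: (order_iso_ltn _ _ 1 0 iso).
  exact: (order_iso_ltn _ _ 0 2 iso).
have [ac bd] := (ltn_trans ab bc, ltn_trans bc cd); have ad := ltn_trans ab bd.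
by rewrite /order_iso /= !ltnn !eqxx !(ltn_cmp ab, ltn_cmp ac, ltn_cmp ad,
                                      ltn_cmp bc, ltn_cmp bd, ltn_cmp cd).
Qed.

Lemma contains2341P w :
  reflect (exists b c d a, [/\ a < b, b < c, c < d & subseq [:: b; c; d; a] w])
          (contains [:: 2; 3; 4; 1] w).
Proof.
apply: (iffP (containsP _ _)) => [[s sw iso] | [b [c [d [a [ab bc cd sw]]]]]].
  have /andP [/eqP] := iso; case: s sw iso => [|b [|c [|d [|a []]]]] // sw.
  by rewrite order_iso2341 => /and3P [ab bc cd] _ _; exists b, c, d, a.
by exists [:: b; c; d; a]; rewrite // order_iso2341 ab bc cd.
Qed.

Lemma sorted_leqPn {s} :
  reflect (exists b a, a < b /\ subseq [:: b; a] s) (~~ sorted leq s).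
Proof.
apply: (iffP idP) => [|[b [a [ab sub]]]]; last first.
  apply/negP => /(subseq_sorted leq_trans sub) /=.
  by rewrite andbT leqNgt ab.
rewrite (sorted_pairwise leq_trans); elim: s => [//|x s IHs] /=.
rewrite negb_and => /orP [/allPn [a a_s] | /IHs [b [a [ab sub]]]].
  by rewrite -ltnNge => ax; exists x, a; rewrite /= eqxx sub1seq.
by exists b, a; split=> //; apply: subseq_trans sub (subseq_cons _ _).
Qed.

(** Turns the push test, a search over index tuples, into one that computes. *)
Lemma avoids21 s : avoids [:: 2; 1] s = sorted leq s.
Proof.
rewrite -[RHS]negbK; congr (~~ _).
apply/containsP/sorted_leqPn => [[t sub iso] | [b [a [ab sub]]]].
  have /andP [/eqP] := iso; case: t sub iso => [|b [|a []]] // sub.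
  by rewrite order_iso21 => ab _ _; exists b, a.
by exists [:: b; a]; rewrite ?order_iso21.
Qed.

(** * Runs of the stack and their splitting at the leftmost maximum *)

Lemma stack21_push a w s : sorted leq (a :: s) ->
  stack21_from (a :: w) s = stack21_from w (a :: s).
Proof. by case: s => [|t s] srt; rewrite /= avoids21 srt. Qed.

Lemma stack21_pop a w t s : ~~ sorted leq [:: a, t & s] ->
  stack21_from (a :: w) (t :: s) = t :: stack21_from (a :: w) s.
Proof. by rewrite /= avoids21 => /negbTE /= ->. Qed.

Arguments stack21_from : simpl never.

(** No remaining letter exceeds m, so m at the bottom never forbids a push and leaves last. *)
Lemma stack21_from_bottom m w s :
  all (fun x => x <= m) w -> sorted leq (rcons s m) ->
  stack21_from w (rcons s m) = rcons (stack21_from w s) m.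
Proof.
elim: w s => [//|a w IHw] s /= /andP [am wm].
(* This inner induction follows the nested fixpoint [popping]. *)
elim: s => [|t s IHs] srt.
  by rewrite !stack21_push //= ?am // (IHw [:: a]) //= am.
have [at_|ta] := leqP a t.
  have srt' : sorted leq (rcons [:: a, t & s] m) by rewrite /= at_.
  rewrite [rcons _ _]/= !stack21_push //; first exact: (IHw [:: a, t & s]).
  apply: subseq_sorted leq_trans _ _ _ srt'.
  by rewrite -[rcons _ _]cats1 prefix_subseq.
rewrite [rcons _ _]/= !stack21_pop ?IHs //=; first exact: path_sorted srt.
- by rewrite leqNgt ta.
- by rewrite leqNgt ta.
Qed.

(** Being strictly larger, m forces out every letter before it is pushed, exactly as the end of the
    input would after L. A letter equal to m would stay, hence the choice of the leftmost
    maximum. *)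
Lemma stack21_from_flush m L R s :
  all (fun x => x < m) L -> all (fun x => x < m) s -> sorted leq s ->
  stack21_from (L ++ m :: R) s = stack21_from L s ++ stack21_from R [:: m].
Proof.
elim: L s => [|a L IHL] s /=.
  move=> _; elim: s => [|t s IHs] /=; first by rewrite stack21_push.
  case/andP=> tm sm srt; rewrite stack21_pop ?IHs ?(path_sorted srt) //=.
  by rewrite leqNgt tm.
case/andP=> am Lm; elim: s => [|t s IHs] /=.
  by move=> _ _; rewrite !stack21_push // IHL //= am.
case/andP=> tm sm srt; have [at_|ta] := leqP a t.
  by rewrite !stack21_push ?IHL //= ?am ?tm ?at_.
by rewrite !stack21_pop ?IHs ?(path_sorted srt) //= leqNgt ta.
Qed.

Lemma stack21_cat_max L m R :
  all (fun x => x < m) L -> all (fun x => x <= m) R ->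
  stack21 (L ++ m :: R) = stack21 L ++ rcons (stack21 R) m.
Proof.
move=> Lm Rm.
(* The stack [[:: m]] is [rcons [::] m]: nothing lies above m yet. *)
by rewrite /stack21 stack21_from_flush // -(stack21_from_bottom _ _ [::]).
Qed.

(** Shaped for [stack21_cat_max]: the bounds, strict on L and weak on R, single out the leftmost
    maximum. L and R are shorter than the word, so induction on length applies. *)
Lemma max_ind (P : seq nat -> Prop) :
  P [::] ->
  (forall L m R, all (fun x => x < m) L -> all (fun x => x <= m) R ->
     P L -> P R -> P (L ++ m :: R)) ->
  forall w, P w.
Proof.
move=> P0 PS w; have [n] := ubnP (size w); elim: n w => // n IHn w.
have [-> //|] := eqVneq w [::] => w0.
have [L [m [R [-> Lm Rm]]]] : exists L m R,
    [/\ w = L ++ m :: R, all (fun x => x < m) L & all (fun x => x <= m) R].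
  elim: w w0 {IHn} => [//|a w IHw] _; have [-> |/IHw] := eqVneq w [::].
    by exists [::], a, [::].
  case=> L [m [R [-> Lm Rm]]]; have [ma|am] := leqP m a.
    (* On a tie the head a wins, since the maximum must be the leftmost. *)
    exists [::], a, (L ++ m :: R); split=> //=; rewrite all_cat /= ma.
    apply/andP; split; apply/allP => x.
      by move/(allP Lm)/ltnW/leq_trans; apply.
    by move/(allP Rm)/leq_trans; apply.
  by exists (a :: L), m, R; rewrite /= am.
rewrite size_cat /= addnS ltnS => lt_n.
by apply: PS => //; apply: IHn; apply: leq_ltn_trans lt_n;
  rewrite ?leq_addr ?leq_addl.
Qed.

Lemma subseq_catP {s u v : seq nat} : subseq s (u ++ v) ->
  exists s1 s2, [/\ s = s1 ++ s2, subseq s1 u & subseq s2 v].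
Proof.
case/subseqP=> m szm ->; rewrite -(cat_take_drop (size u) m).
exists (mask (take (size u) m) u), (mask (drop (size u) m) v).
rewrite !mask_subseq mask_cat // size_takel // szm size_cat.
exact: leq_addr.
Qed.

Lemma mem_stack21 w : stack21 w =i w.
Proof.
elim/max_ind: w => [//|L m R Lm Rm IHL IHR] x.
rewrite stack21_cat_max // mem_cat mem_rcons inE IHL IHR.
by rewrite mem_cat inE.
Qed.

Lemma subseq_cons_neq {x m} {s R : seq nat} :
  x < m -> subseq (x :: s) (m :: R) -> subseq (x :: s) R.
Proof. by move=> xm; rewrite /= (ltn_cmp xm). Qed.

(** Discards the maximum m that ends the output, when a pattern ends with a smaller letter. *)
Lemma subseq_rcons_neq {m a} {s u : seq nat} :
  a < m -> subseq (rcons s a) (rcons u m) -> subseq (rcons s a) u.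
Proof.
by move=> am; rewrite -subseq_rev !rev_rcons => /(subseq_cons_neq am);
   rewrite -rev_rcons subseq_rev.
Qed.

(** * Order of two letters after one pass *)

Lemma cat_max_leq {L m R x} : all (fun x => x < m) L ->
  all (fun x => x <= m) R -> x \in L ++ m :: R -> x <= m.
Proof.
move=> Lm Rm; rewrite mem_cat inE => /or3P [/(allP Lm)/ltnW | /eqP -> | /(allP Rm)] //.
Qed.

(** Meant for c preceding b, where c itself may be output before b. The maximum of w ends the output
    and always serves as c'. *)
Lemma stack21_max_last {w b c} : b \in w -> c \in w -> b < c ->
  exists2 c', b < c' & subseq [:: b; c'] (stack21 w).
Proof.
elim/max_ind: w => [//|L m R Lm Rm _ _] bw cw bc.
have bm := leq_trans bc (cat_max_leq Lm Rm cw).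
exists m => //; rewrite stack21_cat_max // -cats1 catA -[[:: b; m]]cat1s.
apply: cat_subseq => //; rewrite sub1seq mem_cat !mem_stack21.
by move: bw; rewrite mem_cat inE (ltn_cmp bm).
Qed.

(** A letter c cannot be pushed while the smaller b is on the stack, so b leaves first. *)
Lemma stack21_ascent {w b c} : b < c -> subseq [:: b; c] w ->
  subseq [:: b; c] (stack21 w).
Proof.
move=> bc; elim/max_ind: w => [//|L m R Lm Rm IHL IHR] sub.
have cm : c <= m.
  by apply: (cat_max_leq Lm Rm); apply: (mem_subseq sub); rewrite !inE eqxx orbT.
rewrite stack21_cat_max //.
case: (subseq_catP sub) => s1 [s2 []]; case: s1 => [|x [|y [|//]]]; rewrite [_ ++ _]/=.
- move=> <- _ /(subseq_cons_neq (leq_trans bc cm)) /IHR bcR.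
  apply: subseq_trans bcR (subseq_trans (subseq_rcons _ _) (suffix_subseq _ _)).
- case=> <- <-; rewrite !sub1seq => bL cR.
  rewrite -[[:: b; c]]cat1s; apply: cat_subseq; rewrite sub1seq.
    by rewrite mem_stack21.
  by rewrite mem_rcons inE mem_stack21; move: cR; rewrite inE.
- case=> <- <- _ /IHL bcL _.
  exact: subseq_trans bcL (prefix_subseq _ _).
Qed.

(** If b stayed on the stack, the smaller a would enter above it and leave first; only a larger c
    arriving in between expels b in time. At the split, m is such a c when b lies in L and a in
    R. *)
Lemma stack21_descentP w b a : a < b ->
  reflect (exists2 c, b < c & subseq [:: b; c; a] w)
          (subseq [:: b; a] (stack21 w)).
Proof.
move=> ab; apply: (iffP idP).
  elim/max_ind: w => [//|L m R Lm Rm IHL IHR] sub.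
  have bm : b <= m.
    apply: (cat_max_leq Lm Rm); rewrite -mem_stack21.
    by apply: (mem_subseq sub); rewrite inE eqxx.
  move: sub; rewrite stack21_cat_max // -rcons_cat.
  move/(@subseq_rcons_neq m a [:: b] _ (leq_trans ab bm))/subseq_catP.
  case=> s1 [s2 []]; case: s1 => [|x [|y [|//]]]; rewrite [_ ++ _]/=.
  - move=> <- _ /IHR [c bc sub]; exists c => //; apply: subseq_trans sub _.
    exact: subseq_trans (subseq_cons _ _) (suffix_subseq _ _).
  - case=> <- <-; rewrite !sub1seq !mem_stack21 => bL aR.
    exists m; first exact: (allP Lm).
    rewrite -[[:: b; m; a]]cat1s; apply: cat_subseq; rewrite ?sub1seq //=.
    by rewrite eqxx sub1seq.
  - case=> <- <- _ /IHL [c bc sub] _; exists c => //.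
    exact: subseq_trans sub (prefix_subseq _ _).
case=> c bc; elim/max_ind: w => [//|L m R Lm Rm IHL IHR] sub.
have bm : b < m.
  apply: leq_trans bc (cat_max_leq Lm Rm _).
  by apply: (mem_subseq sub); rewrite !inE eqxx orbT.
have am := ltn_trans ab bm.
have aR v : subseq v (m :: R) -> a \in v -> a \in stack21 R.
  by move=> /mem_subseq vR /vR; rewrite inE (ltn_cmp am) mem_stack21.
(* Covers every split of b c a that leaves b in L and a to its right, wherever c falls. *)
have cross u v : subseq u L -> subseq v (m :: R) -> b \in u -> a \in v ->
    subseq [:: b; a] (stack21 L ++ rcons (stack21 R) m).
  move=> uL vR bu av; rewrite -rcons_cat.
  apply: subseq_trans (subseq_rcons _ _); rewrite -[[:: b; a]]cat1s.
  apply: cat_subseq; rewrite sub1seq; last exact: aR vR av.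
  by rewrite mem_stack21 (mem_subseq uL).
rewrite stack21_cat_max //.
case: (subseq_catP sub) => s1 [s2 []]; case: s1 => [|x [|y [|z [|//]]]]; rewrite [_ ++ _]/=.
- move=> <- _ /(subseq_cons_neq bm) /IHR baR.
  apply: subseq_trans baR (subseq_trans (subseq_rcons _ _) (suffix_subseq _ _)).
- by case=> <- <- uL vR; apply: cross uL vR _ _; rewrite !inE eqxx ?orbT.
- by case=> <- <- <- uL vR; apply: cross uL vR _ _; rewrite !inE eqxx ?orbT.
- case=> <- <- <- _ /IHL baL _.
  exact: subseq_trans baL (prefix_subseq _ _).
Qed.

(** * The restricted 3241 (West's 35241 with barred 5), and 231 in the output pulled back to the
    input *)

Definition barred3241 (w : seq nat) : Prop :=
  exists w1 c w2 b w3 d a,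
    [/\ w = w1 ++ c :: w2 ++ b :: w3, subseq [:: d; a] w3,
        [&& a < b, b < c & c < d] & all (fun x => x < d) w2].

(** Stated for factors, not subsequences: a letter inserted between c and b can spoil the
    occurrence, as in 34241, but letters around the word cannot. *)
Lemma barred3241_factor {w} u v : barred3241 w -> barred3241 (u ++ w ++ v).
Proof.
case=> w1 [c [w2 [b [w3 [d [a [-> da abcd w2d]]]]]]].
exists (u ++ w1), c, w2, b, (w3 ++ v), d, a; split=> //.
  by rewrite -!catA /= -catA.
exact: subseq_trans da (prefix_subseq _ _).
Qed.

Lemma contains_subseq {p u v} : subseq u v -> contains p u -> contains p v.
Proof.
move=> uv /containsP [s su iso]; apply/containsP; exists s => //.
exact: subseq_trans su uv.
Qed.

(** Used to locate the letters c and b of [barred3241] relative to the maximum m. *)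
Lemma cat_cons_eq {L R u v : seq nat} {m x} : u ++ x :: v = L ++ m :: R ->
  [\/ exists2 t, L = u ++ x :: t & v = t ++ m :: R,
      x = m
    | exists2 t, u = L ++ m :: t & R = t ++ x :: v].
Proof.
elim: u L => [|y u IHu] [|z L] /= [].
- by constructor 2.
- by move=> -> ->; constructor 1; exists L.
- by move=> -> <-; constructor 3; exists u.
move=> -> /IHu [[t -> ->]|->|[t -> ->]].
- by constructor 1; exists t.
- by constructor 2.
- by constructor 3; exists t.
Qed.

Lemma stack21_231_pattern {w b c a} : a < b -> b < c ->
  subseq [:: b; c; a] (stack21 w) ->
  contains [:: 2; 3; 4; 1] w \/ barred3241 w.
Proof.
move=> ab bc; elim/max_ind: w => [//|L m R Lm Rm IHL IHR] sub.
have cm : c <= m.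
  apply: (cat_max_leq Lm Rm); rewrite -mem_stack21.
  by apply: (mem_subseq sub); rewrite !inE eqxx orbT.
have am := leq_trans (ltn_trans ab bc) cm.
move: sub; rewrite stack21_cat_max // -rcons_cat.
move/(@subseq_rcons_neq m a [:: b; c] _ am)/subseq_catP.
case=> s1 [s2 []]; case: s1 => [|x [|y [|z [|//]]]]; rewrite [_ ++ _]/=.
- move=> <- _ /IHR [sub|bar]; [left | right].
    apply: contains_subseq sub.
    exact: subseq_trans (subseq_cons _ _) (suffix_subseq _ _).
  by have := barred3241_factor (rcons L m) [::] bar; rewrite cats0 cat_rcons.
- case=> <- <-; rewrite sub1seq mem_stack21 => bL.
  (* The descent c a inside [stack21 R] supplies the 4 of a 2341. *)
  case/(stack21_descentP _ _ _ (ltn_trans ab bc)) => d cd cda.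
  left; apply/contains2341P; exists b, c, d, a; split=> //.
  rewrite -[[:: b, c & _]]cat1s; apply: cat_subseq; first by rewrite sub1seq.
  exact: subseq_trans cda (subseq_cons _ _).
- case=> <- <- <- bcL; rewrite sub1seq mem_stack21 => aR.
  have [bL cL] : b \in L /\ c \in L.
    by rewrite -!(mem_stack21 L) !(mem_subseq bcL) // !inE eqxx ?orbT.
  (* The order of b and c in the output does not determine their order in L, so b is sought on both
     sides of a chosen c. *)
  case/splitPr: cL bL Lm {bcL IHL} => w1 w2.
  rewrite mem_cat inE (ltn_cmp bc) /= all_cat /=.
  move=> b_w12 /and3P [_ c_m w2m]; case/orP: b_w12 => [b1 | b2].
    left; apply/contains2341P; exists b, c, m, a; split=> //.
    rewrite -catA -[[:: b, c & _]]cat1s; apply: cat_subseq; first by rewrite sub1seq.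
    rewrite /= eqxx -[[:: m; a]]cat0s; apply: cat_subseq; first exact: sub0seq.
    by rewrite /= eqxx sub1seq.
  case/splitPr: b2 w2m => w3 w4; rewrite all_cat => /andP [w3m _].
  right; exists w1, c, w3, b, (w4 ++ m :: R), m, a; split=> //.
  - by rewrite -!catA /= -catA.
  - rewrite -[[:: m; a]]cat0s; apply: cat_subseq; first exact: sub0seq.
    by rewrite /= eqxx sub1seq.
  - by rewrite ab bc.
- case=> <- <- <- _ /IHL [sub|bar] _; [left | right].
    exact: contains_subseq (prefix_subseq _ _) sub.
  exact: (barred3241_factor [::]).
Qed.

(** * From the patterns in the input to 231 in the output *)

Definition stack21_has231 (w : seq nat) : Prop :=
  exists b c a, [/\ a < b, b < c & subseq [:: b; c; a] (stack21 w)].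

Lemma stack21_has231_cat {L m R} : all (fun x => x < m) L ->
  all (fun x => x <= m) R ->
  stack21_has231 L \/ stack21_has231 R -> stack21_has231 (L ++ m :: R).
Proof.
move=> Lm Rm [] [b [c [a [ab bc sub]]]]; exists b, c, a; split=> //;
  rewrite stack21_cat_max //; apply: subseq_trans sub _.
  exact: prefix_subseq.
exact: subseq_trans (subseq_rcons _ _) (suffix_subseq _ _).
Qed.

(** The ascent b c survives the pass, and d expels c ahead of a. With repeated letters these two
    facts may concern different copies of c, hence the induction. *)
Lemma pattern2341_stack21 {w} :
  contains [:: 2; 3; 4; 1] w -> stack21_has231 w.
Proof.
elim/max_ind: w => [|L m R Lm Rm IHL IHR] /contains2341P.
  by case=> b [c [d [a []]]].
case=> b [c [d [a [ab bc cd sub]]]].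
have dm : d <= m.
  by apply: (cat_max_leq Lm Rm); apply: (mem_subseq sub); rewrite !inE eqxx !orbT.
have cm := leq_trans cd dm; have bm := ltn_trans bc cm.
have am := ltn_trans ab bm.
have cross u v : subseq [:: b, c & u] L -> subseq v (m :: R) -> a \in v ->
    stack21_has231 (L ++ m :: R).
  move=> bcL vR av; exists b, c, a; split=> //.
  rewrite stack21_cat_max // -rcons_cat.
  apply: subseq_trans (subseq_rcons _ _).
  rewrite -[[:: b; c; a]]/([:: b; c] ++ [:: a]); apply: cat_subseq.
    apply: stack21_ascent bc (subseq_trans _ bcL).
    exact: (prefix_subseq [:: b; c]).
  move/(mem_subseq vR): av.
  by rewrite sub1seq mem_stack21 inE (ltn_cmp am).
case: (subseq_catP sub) => s1 [s2 []].
case: s1 => [|x [|y [|z [|t [|//]]]]]; rewrite [_ ++ _]/=.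
- move=> <- _ /(subseq_cons_neq bm) bcda; apply: stack21_has231_cat => //.
  by right; apply: IHR; apply/contains2341P; exists b, c, d, a.
- case=> <- <-; rewrite sub1seq => bL /(subseq_cons_neq cm) cda.
  exists b, c, a; split=> //; rewrite stack21_cat_max // -rcons_cat.
  apply: subseq_trans (subseq_rcons _ _); rewrite -[[:: b; c; a]]cat1s.
  apply: cat_subseq; first by rewrite sub1seq mem_stack21.
  by apply/(stack21_descentP _ _ _ (ltn_trans ab bc)); exists d.
- by case=> <- <- <- uL vR; apply: cross uL vR _; rewrite !inE eqxx ?orbT.
- by case=> <- <- <- <- uL vR; apply: cross uL vR _; rewrite !inE eqxx ?orbT.
- case=> <- <- <- <- _ bcda _; apply: stack21_has231_cat => //.
  by left; apply: IHL; apply/contains2341P; exists b, c, d, a.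
Qed.

(** The gap condition keeps c and b on the same side of m. If both are in L and a is in R, the
    output has b c' a for some c' > b, possibly other than c. *)
Lemma barred3241_stack21 {w} : barred3241 w -> stack21_has231 w.
Proof.
elim/max_ind: w => [|L m R Lm Rm IHL IHR].
  by case=> [[|? ?]] [? [? [? [? [? [? []]]]]]].
case=> w1 [c [w2 [b [w3 [d [a [eq_w da /and3P [ab bc cd] w2d]]]]]]].
have dm : d <= m.
  apply: (cat_max_leq Lm Rm); rewrite eq_w.
  rewrite !(mem_cat, inE) (mem_subseq da) ?orbT //.
  by rewrite inE eqxx.
have cm := leq_trans cd dm; have bm := ltn_trans bc cm.
have am := ltn_trans ab bm.
case: (cat_cons_eq (esym eq_w)) => [[t eqL eq2]|cE|[t _ eqR]]; first last.
- apply: stack21_has231_cat => //; right; apply: IHR.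
  by exists t, c, w2, b, w3, d, a; split=> //; rewrite ab bc.
- by rewrite cE ltnn in cm.
case: (cat_cons_eq eq2) => [[t' eqt eq3]|bE|[t' eqw2 _]]; first last.
(* Here m would lie in the gap, whose letters are all below d <= m. *)
- by move: w2d; rewrite eqw2 all_cat /= ltnNge dm andbF.
- by rewrite bE ltnn in bm.
have cross : a \in m :: R -> stack21_has231 (L ++ m :: R).
  rewrite inE (ltn_cmp am) => aR.
  have bL : b \in L by rewrite eqL eqt !(mem_cat, inE) eqxx !orbT.
  have cL : c \in L by rewrite eqL !(mem_cat, inE) eqxx !orbT.
  have [c' bc' sub] := stack21_max_last bL cL bc.
  exists b, c', a; split=> //; rewrite stack21_cat_max // -rcons_cat.
  apply: subseq_trans (subseq_rcons _ _).
  rewrite -[[:: b; c'; a]]/([:: b; c'] ++ [:: a]); apply: cat_subseq => //.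
  by rewrite sub1seq mem_stack21.
move: da; rewrite eq3 => /subseq_catP [s1 [s2 []]].
case: s1 => [|x [|y [|//]]]; rewrite [_ ++ _]/=.
- by move=> <- _ /mem_subseq daR; apply/cross/daR; rewrite !inE eqxx orbT.
- by case=> _ <- _; rewrite sub1seq => /cross.
case=> <- <- _ daL _; apply: stack21_has231_cat => //; left; apply: IHL.
exists w1, c, w2, b, t', d, a; split=> //; first by rewrite eqL eqt.
by rewrite ab bc.
Qed.

(** * The characterisation in letters and in positions, and the failure of closure *)

Lemma sortable21Pn w :
  ~ sortable21 w <-> contains [:: 2; 3; 4; 1] w \/ barred3241 w.
Proof.
split.
  case/negP/sorted_leqPn => b [a [ab /(stack21_descentP _ _ _ ab) [c bc sub]]].
  exact: stack21_231_pattern ab bc sub.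
move=> pat; have [b [c [a [ab bc sub]]]] : stack21_has231 w.
  by case: pat => [/pattern2341_stack21|/barred3241_stack21].
apply/negP/sorted_leqPn; exists b, a; split=> //.
by apply/stack21_descentP => //; exists c.
Qed.

Lemma barred3241P w : barred3241 w <->
  exists i1 i2 i3 i4 : nat,
    occurrence [:: 3; 2; 4; 1] w [:: i1; i2; i3; i4] /\
    (forall x : nat, i1 < x -> x < i2 -> nth 0 w x < nth 0 w i3).
Proof.
split.
  case=> w1 [c [w2 [b [w3 [d [a [eq_w /subseq_indices [idx]]]]]]]].
  case: idx => [|j3 [|j4 [|? ?]]] [] //= srt lt_j [dE aE] abcd w2d.
  pose i1 := size w1; pose i2 := (i1 + size w2).+1.
  have nth1 j : nth 0 w (i1 + j) = nth 0 (c :: w2 ++ b :: w3) j.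
    by rewrite eq_w nth_cat ltnNge leq_addr addKn.
  have nth2 j : nth 0 w (i2 + j) = nth 0 (b :: w3) j.
    rewrite addSnnS -addnA nth1 addnS /= nth_cat.
    by rewrite ltnNge leq_addr addKn.
  have size_w : size w = i2 + (size w3).+1.
    by rewrite eq_w size_cat /= size_cat /= addSn addnS addnA.
  have i2E : i2 = (i1 + size w2).+1 by [].
  (* w3 starts just after position i2, so its position j is [i2 + j.+1] in w. *)
  clearbody i2; exists i1, i2, (i2 + j3.+1), (i2 + j4.+1); split.
    rewrite occurrenceE; apply/and3P; split.
    + move: srt; rewrite /= !andbT => srt.
      rewrite ltn_add2l ltnS srt andbT; apply/andP; split.
        by rewrite i2E ltnS leq_addr.
      by rewrite addnS ltnS leq_addr.
    + case/and3P: lt_j => lt3 lt4 _.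
      rewrite size_w /= !ltn_add2l !ltnS lt3 lt4 !andbT addnS !ltnS leq_addr.
      by rewrite i2E addSn -addnA leqW ?leq_addr.
    + have -> : [seq nth 0 w i | i <- [:: i1; i2; i2 + j3.+1; i2 + j4.+1]]
                = [:: c; b; d; a].
        by rewrite dE aE /= !nth2 -(addn0 i1) -(addn0 i2) nth1 nth2.
      by rewrite order_iso3241.
  move=> x lt1 lt2; rewrite nth2 /= -dE -(subnKC lt1) addSnnS nth1 /=.
  have lt_x : x - i1.+1 < size w2 by rewrite ltn_subLR // addSn -i2E.
  by rewrite nth_cat lt_x (allP w2d) // mem_nth.
case=> i1 [i2 [i3 [i4 [occ gap]]]].
move: occ; rewrite occurrenceE => /and3P [/= /and4P [lt12 lt23 lt34 _]].
case/and5P=> lt1 lt2 lt3 lt4 _; rewrite order_iso3241 => abcd.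
(* The gap consists of the [i2 - i1.+1] letters that follow position i1. *)
exists (take i1 w), (nth 0 w i1), (take (i2 - i1.+1) (drop i1.+1 w)),
  (nth 0 w i2), (drop i2.+1 w), (nth 0 w i3), (nth 0 w i4); split=> //.
- have -> : nth 0 w i2 :: drop i2.+1 w = drop (i2 - i1.+1) (drop i1.+1 w).
    by rewrite drop_drop subnK // -drop_nth.
  by rewrite cat_take_drop -drop_nth // cat_take_drop.
- have lt24 := ltn_trans lt23 lt34.
  rewrite -(subnKC lt23) -(subnKC lt24) -!nth_drop.
  apply: (subseq_nth _ [:: i3 - i2.+1; i4 - i2.+1]) => /=.
    by rewrite andbT ltn_sub2r // (leq_ltn_trans lt23 lt34).
  by rewrite size_drop !ltn_sub2r // (leq_ltn_trans lt23 lt3).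
- apply/(all_nthP 0) => j; rewrite size_take_min leq_min => /andP [ltj _].
  rewrite nth_take // nth_drop; apply: gap; first by rewrite addSn ltnS leq_addr.
  by rewrite -ltn_subRL.
Qed.

Theorem theorem6 :
  (forall w : seq nat, cayley w ->
     (~ sortable21 w <->
      contains [:: 2; 3; 4; 1] w \/
      (exists i1 i2 i3 i4 : nat,
         occurrence [:: 3; 2; 4; 1] w [:: i1; i2; i3; i4] /\
         (forall x : nat, i1 < x -> x < i2 -> nth 0 w x < nth 0 w i3)))) /\
  ~ is_class Sort21 /\
  (Sort21 [:: 3; 4; 2; 4; 1] /\
   (cayley [:: 3; 2; 4; 1] /\ ~ sortable21 [:: 3; 2; 4; 1]) /\
   contains [:: 3; 2; 4; 1] [:: 3; 4; 2; 4; 1]).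
Proof.
have sort34241 : Sort21 [:: 3; 4; 2; 4; 1].
  split; first by rewrite /cayley !big_cons big_nil.
  rewrite /sortable21 /stack21.
  (* Both passes are replayed move by move, each move justified by a sortedness test on a concrete
     stack. *)
  by repeat (rewrite stack21_push; last by []) || (rewrite stack21_pop; last by []).
have cayley3241 : cayley [:: 3; 2; 4; 1].
  by rewrite /cayley !big_cons big_nil.
have unsort3241 : ~ sortable21 [:: 3; 2; 4; 1].
  apply/sortable21Pn; right.
  (* The letters 3 and 2 are adjacent, so the gap is empty. *)
  by exists [::], 3, [::], 2, [:: 4; 1], 4, 1.
have sub3241 : contains [:: 3; 2; 4; 1] [:: 3; 4; 2; 4; 1].
  by apply/containsP; exists [:: 3; 2; 4; 1].
split; last split=> //.
  by move=> w _; have := sortable21Pn w; have := barred3241P w; tauto.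
case=> _ down; apply: unsort3241.
exact: (proj2 (down _ _ sort34241 cayley3241 sub3241)).
Qed.
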